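(* Let $H$ be a real Hilbert space, let $K_1,\ldots,K_n$ be closed convex cones in $H$ such that $K_1\cap\cdots\cap K_n=\{0\}$, and let $\zeta$ be a norm on $\mathbb{R}^n$ that is coordinatewise monotone on $\mathbb{R}_+^n$. Define, for $x\in H$, \[ \eta(x)=\zeta\bigl(d(x,K_1),\ldots,d(x,K_n)\bigr)=\zeta\bigl(\lVert P_{K_1^\circ}x\rVert,\ldots,\lVert P_{K_n^\circ}x\rVert\bigr). \] Then $\eta$ is sublinear, and for every $x\in H$, $\eta(x)=0$ if and only if $x=0$. In particular, $\eta$ is an asymmetric seminorm.
   Context: $H$ is a real Hilbert space with inner product $\langle\cdot,\cdot\rangle$ and norm $\lVert x\rVert=\sqrt{\langle x,x\rangle}$. A closed convex cone is a nonempty closed set $K\subseteq H$ such that $\lambda x+\mu y\in K$ for all $x,y\in K$ and all real $\lambda,\mu\ge 0$. The dual cone is $K^*=\{x\in H:\langle x,y\rangle\ge 0\text{ for every }y\in K\}$ and the polar cone is $K^\circ=-K^*$. $d(x,K)=\min_{y\in K}\lVert x-y\rVert$, and $P_Kx$ is the metric projection of $x$ onto $K$, i.e. the unique point of $K$ with $\lVert x-P_Kx\rVert=d(x,K)$; one has $d(x,K)=\lVert P_{K^\circ}x\rVert$. $\mathbb{R}_+=\{t\in\mathbb{R}:t\ge 0\}$. A norm $\zeta$ on $\mathbb{R}^n$ is coordinatewise monotone on $\mathbb{R}_+^n$ if $0\le a_i\le b_i$ for $i=1,\ldots,n$ implies $\zeta(a_1,\ldots,a_n)\le\zeta(b_1,\ldots,b_n)$.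 A function $q:H\to\mathbb{R}$ is sublinear if $q(\lambda x)=\lambda q(x)$ and $q(x+y)\le q(x)+q(y)$ for all real $\lambda\ge 0$ and all $x,y\in H$. An asymmetric seminorm is a sublinear function $q:H\to\mathbb{R}_+$ such that $q(x)=q(-x)=0$ implies $x=0$. *)

(* Defs.v *)
From HB Require Import structures.
From mathcomp Require Import all_boot all_order all_algebra.
From mathcomp Require Import all_classical all_reals all_analysis.
From mathcomp Require Import ring lra.

Set Implicit Arguments.
Unset Strict Implicit.
Unset Printing Implicit Defensive.

Import Order.TTheory GRing.Theory Num.Theory.
Import numFieldNormedType.Exports.

Local Open Scope classical_set_scope.
Local Open Scope ring_scope.

(* A real Hilbert space is a completeNormedModType H over a realType R together
   with an inner product ip : {dot H for idfun} (bilinear, symmetric, positive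
   definite) inducing the norm of H. *)
Definition induces_norm (R : realType) (H : normedModType R)
    (ip : {dot H for idfun}) : Prop :=
  forall x : H, `|x| = Num.sqrt (ip x x).

Definition closed_convex_cone (R : realType) (H : normedModType R)
    (K : set H) : Prop :=
  [/\ K !=set0, closed K &
      forall (x y : H) (l m : R),
        K x -> K y -> 0 <= l -> 0 <= m -> K (l *: x + m *: y)].

Definition dual_cone (R : realType) (H : normedModType R)
    (ip : {dot H for idfun}) (K : set H) : set H :=
  [set x | forall y, K y -> 0 <= ip x y].

Definition polar_cone (R : realType) (H : normedModType R)
    (ip : {dot H for idfun}) (K : set H) : set H :=
  [set - x | x in dual_cone ip K].

(* On a closed convex cone of a Hilbert space the infimum is attained, at a
   single point, so that it is a minimum: see dist_attained below. *)
Definition dist (R : realType) (H : normedModType R) (x : H) (K : set H) : R :=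
  inf [set `|x - y| | y in K].

(* The default value 0 is irrelevant on closed convex cones: see metric_projP. *)
Definition metric_proj (R : realType) (H : normedModType R)
    (K : set H) (x : H) : H :=
  xget 0 [set y | K y /\ `|x - y| = dist x K].

Definition is_norm (R : realType) (n : nat) (zeta : 'rV[R]_n -> R) : Prop :=
  [/\ forall u, 0 <= zeta u,
      forall u, zeta u = 0 -> u = 0,
      forall (a : R) u, zeta (a *: u) = `|a| * zeta u &
      forall u v, zeta (u + v) <= zeta u + zeta v].

Definition coordinatewise_monotone (R : realType) (n : nat)
    (zeta : 'rV[R]_n -> R) : Prop :=
  forall a b : 'rV[R]_n,
    (forall i, 0 <= a ord0 i /\ a ord0 i <= b ord0 i) -> zeta a <= zeta b.

Definition sublinear (R : realType) (H : normedModType R) (q : H -> R) : Prop :=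
  (forall (l : R) x, 0 <= l -> q (l *: x) = l * q x) /\
  (forall x y, q (x + y) <= q x + q y).

Definition asymmetric_seminorm (R : realType) (H : normedModType R)
    (q : H -> R) : Prop :=
  [/\ sublinear q,
      forall x, 0 <= q x &
      forall x, q x = 0 -> q (- x) = 0 -> x = 0].

Section MetricProjection.
Variables (R : realType) (H : completeNormedModType R).
Variables (ip : {dot H for idfun}) (ipN : induces_norm ip).

Lemma normr_ipE (x : H) : `|x| ^+ 2 = ip x x.
Proof.
rewrite ipN sqr_sqrtr//; have [->|x0] := eqVneq x 0.
  by rewrite linear0r.
exact/ltW/neq0_dnorm_gt0.
Qed.

Lemma ip_parallelogram (x y : H) :
  `|x + y| ^+ 2 + `|x - y| ^+ 2 = 2 * (`|x| ^+ 2 + `|y| ^+ 2).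
Proof.
rewrite !normr_ipE [ip (x + y) _]linearDl [ip (x - y) _]linearBl.
by rewrite /= !linearDr !linearNr /=; ring.
Qed.

Variable K : set H.
Hypothesis cccK : closed_convex_cone K.

Lemma dist_ge0 x : 0 <= dist x K.
Proof.
have [[k0 Kk0] _ _] := cccK.
by apply: lb_le_inf => [|_ [k _ <-]//]; exists `|x - k0|, k0.
Qed.

Lemma dist_le x y : K y -> dist x K <= `|x - y|.
Proof.
by move=> Ky; apply: ge_inf; [exists 0 => _ [k _ <-] | exists y].
Qed.

Lemma dist_near x (e : R) : 0 < e -> exists2 y, K y & `|x - y| < dist x K + e.
Proof.
have [[k0 Kk0] _ _] := cccK.
move=> e0; have hi : has_inf [set `|x - y| | y in K].
  by split; [exists `|x - k0|, k0 | exists 0 => _ [k _ <-]].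
by have [_ [y Ky <-] ?] := inf_adherent e0 hi; exists y.
Qed.

Lemma dist_cauchy x y z (e : R) : 0 <= e -> K y -> K z ->
  `|x - y| <= dist x K + e -> `|x - z| <= dist x K + e ->
  `|y - z| ^+ 2 <= 4 * e * (2 * dist x K + e).
Proof.
have [_ _ cK] := cccK => e0 Ky Kz xy xz.
have d0 := dist_ge0 x.
have := ip_parallelogram (x - y) (x - z).
have -> : x - y + (x - z) = 2 *: (x - (2^-1 *: y + 2^-1 *: z)).
  rewrite !scalerBr scalerDr !scalerA mulfV ?pnatr_eq0// !scale1r.
  by rewrite scaler_nat mulr2n addrACA opprD.
rewrite normrZ (@ger0_norm _ 2)//.
have -> : x - y - (x - z) = - (y - z).
  by rewrite opprB addrC addrA subrK opprB.
rewrite normrN.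
have := dist_le x (cK y z 2^-1 2^-1 Ky Kz _ _).
rewrite !invr_ge0 !ler0n => /(_ isT isT).
move: (normr_ge0 (x - y)) (normr_ge0 (x - z)) xy xz d0.
move: `|x - y| `|x - z| `|y - z| `|x - (_ + _)| (dist x K) => a b c m d.
move=> a0 b0 ad bd d0 dm par.
have ha : a ^+ 2 <= (d + e) ^+ 2 by apply: lerXn2r; rewrite ?nnegrE ?addr_ge0.
have hb : b ^+ 2 <= (d + e) ^+ 2 by apply: lerXn2r; rewrite ?nnegrE ?addr_ge0.
have hm : d ^+ 2 <= m ^+ 2 by apply: lerXn2r; rewrite ?nnegrE // (le_trans d0).
rewrite !exprMn !expr2 in par ha hb hm *; lra.
Qed.

Lemma dist_attained x : exists! y, K y /\ `|x - y| = dist x K.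
Proof.
have [_ clK cK] := cccK.
pose F := filter_from [set e : R | 0 < e]
  (fun e => [set y | K y /\ `|x - y| < dist x K + e]).
have FF : ProperFilter F.
  apply: filter_from_proper.
    apply: filter_from_filter; first by exists 1; rewrite /= ltr01.
    move=> i j /= i0 j0; exists (Num.min i j).
      by rewrite /= lt_min i0.
    move=> y [Ky yd]; split; split=> //; apply: (lt_le_trans yd);
      by rewrite lerD2l ge_min lexx ?orbT.
  by move=> e e0; have [y Ky ?] := dist_near x e0; exists y.
have d0 := dist_ge0 x.
have Fc : cauchy F.
  apply/cauchy_exP => e e0.
  pose c := Num.min 1 (e ^+ 2 / (4 * (2 * dist x K + 1) + 1)).
  have D0 : 0 < 4 * (2 * dist x K + 1) + 1 by lra.
  have c0 : 0 < c by rewrite lt_min ltr01 divr_gt0 ?exprn_gt0.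
  have [y Ky yd] := dist_near x c0.
  exists y; exists c => // z [Kz zd].
  rewrite -ball_normE /= -ltr_sqr ?nnegrE ?(ltW e0)//.
  apply: le_lt_trans (dist_cauchy (ltW c0) Ky Kz (ltW yd) (ltW zd)) _.
  have c1 : c <= 1 by rewrite ge_min lexx.
  have : c <= e ^+ 2 / (4 * (2 * dist x K + 1) + 1) by rewrite ge_min lexx orbT.
  rewrite ler_pdivlMr// => h; apply: lt_le_trans h; nra.
have [p Fp] : exists p : H, F --> p by apply/cvg_ex; exact: cauchy_cvg.
have FK : F K by exists 1 => [|y []//]; rewrite /= ltr01.
have Kp : K p by exact: (@closed_cvg _ _ F _ id K clK FK p Fp).
have pd : `|x - p| <= dist x K.
  apply/ler_addgt0Pr => e e0.
  have FB : F (ball p (e / 2)) by apply: Fp; apply: nbhsx_ballx; rewrite divr_gt0.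
  have FE : F [set y | K y /\ `|x - y| < dist x K + e / 2].
    by exists (e / 2) => //=; rewrite divr_gt0.
  have [y [yb [Ky yd]]] := filter_ex (filterI FB FE).
  move: yb; rewrite -ball_normE /= distrC => yp.
  have := ler_distD y x p; lra.
exists p; split; first by split=> //; apply/le_anti; rewrite pd dist_le.
move=> q [Kq qd].
have qd0 : `|x - q| <= dist x K + 0 by rewrite addr0 qd.
have pd0 : `|x - p| <= dist x K + 0 by rewrite addr0.
have := dist_cauchy (lexx 0) Kp Kq pd0 qd0.
rewrite mulr0 mul0r => h; apply/eqP; rewrite -subr_eq0 -normr_eq0.
by rewrite -sqrf_eq0 eq_le h sqr_ge0.
Qed.

Lemma metric_projP x :
  K (metric_proj K x) /\ `|x - metric_proj K x| = dist x K.
Proof.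
have [y [yP _]] := dist_attained x.
by apply: (@xgetPex _ 0 [set z | K z /\ `|x - z| = dist x K]); exists y.
Qed.

End MetricProjection.

(* Main.v *)
Require Import Defs.
From HB Require Import structures.
From mathcomp Require Import all_boot all_order all_algebra.
From mathcomp Require Import all_classical all_reals all_analysis.
From mathcomp Require Import ring lra.

(** Everything reduces to properties of the distance to a single closed convex
    cone K. Comparing x and y with their projections shows that the distance
    to K is subadditive and positively homogeneous, because K is stable under
    addition and nonnegative scaling ([dist_coneD], [dist_coneZ]); it vanishes
    exactly on K ([dist_cone_eq0]). A monotone norm keeps sublinearity in each
    coordinate, and a norm vanishes only at the zero vector, so that eta x = 0
    means that x lies in every K_i, that is, x = 0.

    The two expressions of eta agree by Moreau's decomposition: if p is the
    projection of x onto K, the variational inequality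
    <x - p, k - p> <= 0 on K gives, K being a cone, x - p in the polar cone and
    <x - p, p> = 0. For q in the polar cone, <p, q> <= 0 then yields
    |x - q|^2 >= |p|^2 + |(x - p) - q|^2, so that x - p is the only nearest
    point to x in the polar cone ([metric_proj_polar]). *)

Set Implicit Arguments.
Unset Strict Implicit.
Unset Printing Implicit Defensive.

Import Order.TTheory GRing.Theory Num.Theory.
Import numFieldNormedType.Exports.

Local Open Scope classical_set_scope.
Local Open Scope ring_scope.

Section Cone.
Variables (R : realType) (H : completeNormedModType R).
Variables (ip : {dot H for idfun}) (ipN : induces_norm ip).

Lemma ipC (x y : H) : ip x y = ip y x.
Proof. by have := hermC ip x y; rewrite expr0 mul1r. Qed.

Lemma normrD_ip (x y : H) :
  `|x + y| ^+ 2 = `|x| ^+ 2 + 2 * ip x y + `|y| ^+ 2.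
Proof.
by rewrite !(normr_ipE ipN) [ip (x + y) _]linearDl /= !linearDr /= (ipC y x); ring.
Qed.

Variable K : set H.
Hypothesis cccK : closed_convex_cone K.

Lemma cone0 : K 0.
Proof.
have [[k Kk] _ cK] := cccK.
by have := cK k k 0 0 Kk Kk (lexx _) (lexx _); rewrite !scale0r addr0.
Qed.

Lemma coneD x y : K x -> K y -> K (x + y).
Proof.
have [_ _ cK] := cccK => Kx Ky.
by have := cK x y 1 1 Kx Ky ler01 ler01; rewrite !scale1r.
Qed.

Lemma coneZ (l : R) x : 0 <= l -> K x -> K (l *: x).
Proof.
have [_ _ cK] := cccK => l0 Kx.
by have := cK x x l 0 Kx Kx l0 (lexx _); rewrite scale0r addr0.
Qed.

(** The derivative of |x - (p + t v)|^2 at t = 0, where p is the projection, is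
    - 2 <x - p, v>; it cannot be negative when p + t v stays in K. *)
Lemma metric_proj_variational x (p := metric_proj K x) v :
  (forall t : R, 0 <= t <= 1 -> K (p + t *: v)) -> ip (x - p) v <= 0.
Proof.
move=> Kv; rewrite leNgt; apply/negP.
have [_ xp] := metric_projP ipN cccK x; rewrite -/p in xp.
set a := ip _ _ => a0; pose b := `|v| ^+ 2.
have b0 : 0 <= b by rewrite sqr_ge0.
have ab0 : 0 < a + b by lra.
(* any step t <= 1 with t b < 2 a decreases the distance *)
pose t := a / (a + b).
have t0 : 0 < t by rewrite divr_gt0.
have t1 : t <= 1 by rewrite ler_pdivrMr// mul1r; lra.
have tE : t * (a + b) = a by rewrite mulfVK// gt_eqF.
have Kt : K (p + t *: v) by apply: Kv; rewrite ltW.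
have := dist_le x Kt.
rewrite -xp opprD addrA -ler_sqr ?nnegrE// (normrD_ip (x - p)) normrN normrZ.
rewrite (gtr0_norm t0) exprMn linearNr /= linearZr_LR /= -/a -/b => le_sq.
have : 0 <= t * (t * b - 2 * a) by rewrite expr2 in le_sq; lra.
by rewrite pmulr_rge0//; nra.
Qed.

Lemma ip_metric_proj_le0 x k : K k -> ip (x - metric_proj K x) k <= 0.
Proof.
move=> Kk; apply: metric_proj_variational => t /andP[t0 _].
by apply: coneD; [case: (metric_projP ipN cccK x)|exact: coneZ].
Qed.

(** The segment from p to the apex of the cone stays in K, so that both p and
    - p are admissible directions in the variational inequality. *)
Lemma ip_metric_proj_eq0 x : ip (x - metric_proj K x) (metric_proj K x) = 0.
Proof.
have [Kp _] := metric_projP ipN cccK x.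
apply/le_anti; rewrite ip_metric_proj_le0//=.
rewrite -oppr_le0 -[X in X <= _]linearNr.
apply: metric_proj_variational => t /andP[_ t1].
rewrite scalerN -[X in X - _]scale1r -scalerBl.
by apply: coneZ; rewrite ?subr_ge0.
Qed.

Lemma polar_coneP z : polar_cone ip K z <-> forall k, K k -> ip z k <= 0.
Proof.
split=> [[w wK <-] k Kk|zK].
  by rewrite linearNl oppr_le0; exact: wK.
exists (- z); last exact: opprK.
by move=> k Kk; rewrite linearNl oppr_ge0; exact: zK.
Qed.

(** Moreau's decomposition. The obtuse angle between p and the polar cone makes
    x - p strictly closer to x than any other polar point, which identifies the
    projection onto the polar cone without knowing beforehand that it exists. *)
Lemma metric_proj_polar x :
  metric_proj (polar_cone ip K) x = x - metric_proj K x.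
Proof.
have [Kp _] := metric_projP ipN cccK x.
set p := metric_proj K x in Kp *.
have polp : polar_cone ip K (x - p).
  by apply/polar_coneP => k; exact: ip_metric_proj_le0.
have far q : polar_cone ip K q ->
    `|p| ^+ 2 + `|(x - p) - q| ^+ 2 <= `|x - q| ^+ 2.
  move=> /polar_coneP /(_ p Kp) qp.
  have -> : x - q = p + ((x - p) - q) by rewrite addrA (addrC p) subrK.
  rewrite (normrD_ip p) linearBr /= (ipC p (x - p)) ip_metric_proj_eq0 (ipC p q).
  lra.
have distp : dist x (polar_cone ip K) = `|p|.
  apply/le_anti/andP; split.
    apply: ge_inf; first by exists 0 => _ [k _ <-].
    by exists (x - p) => //; rewrite opprB addrC subrK.
  apply: lb_le_inf; first by exists `|x - (x - p)|, (x - p).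
  move=> _ [q /far fq <-]; rewrite -ler_sqr ?nnegrE//.
  by apply: le_trans fq; rewrite lerDl sqr_ge0.
have [|polq xq] := @xgetPex _ 0
    [set y | polar_cone ip K y /\ `|x - y| = dist x (polar_cone ip K)].
  by exists (x - p); split=> //; rewrite opprB addrC subrK distp.
rewrite -/(metric_proj _ _) in polq xq *.
apply/esym/eqP; rewrite -subr_eq0 -normr_eq0 -sqrf_eq0 eq_le sqr_ge0 andbT.
by have := far _ polq; rewrite xq distp gerDl.
Qed.

Lemma dist_coneD x y : dist (x + y) K <= dist x K + dist y K.
Proof.
have [Kp <-] := metric_projP ipN cccK x.
have [Kq <-] := metric_projP ipN cccK y.
apply: le_trans (dist_le _ (coneD Kp Kq)) _.
by rewrite opprD addrACA ler_normD.
Qed.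

Lemma dist_coneZ (l : R) x : 0 <= l -> dist (l *: x) K = l * dist x K.
Proof.
(* the inequality for 1/l at l x is the converse inequality for l at x *)
have le_dist (m : R) y : 0 <= m -> dist (m *: y) K <= m * dist y K.
  move=> m0; have [Kp <-] := metric_projP ipN cccK y.
  apply: le_trans (dist_le _ (coneZ m0 Kp)) _.
  by rewrite -scalerBr normrZ ger0_norm.
move=> l0; apply/le_anti; rewrite le_dist//=.
have [->|l_neq0] := eqVneq l 0; first by rewrite mul0r dist_ge0.
have lp : 0 < l by rewrite lt0r l_neq0.
have := @le_dist l^-1 (l *: x).
by rewrite invr_ge0 scalerA mulVf// scale1r mulrC ler_pdivlMr// mulrC; exact.
Qed.

Lemma dist_cone_eq0 x : dist x K = 0 <-> K x.
Proof.
have [Kp xp] := metric_projP ipN cccK x; split=> [d0|Kx].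
  by move: xp; rewrite d0 => /normr0_eq0/subr0_eq ->.
apply/le_anti; rewrite dist_ge0// andbT.
by have := dist_le x Kx; rewrite subrr normr0.
Qed.

End Cone.

Theorem theorem6p2 (R : realType) (H : completeNormedModType R)
    (ip : {dot H for idfun}) (n : nat) (K : 'I_n -> set H)
    (zeta : 'rV[R]_n -> R) :
  induces_norm ip ->
  (forall i, closed_convex_cone (K i)) ->
  \bigcap_(i in [set: 'I_n]) K i = [set 0] ->
  is_norm zeta ->
  coordinatewise_monotone zeta ->
  let eta := fun x : H => zeta (\row_(i < n) dist x (K i)) in
  [/\ forall x, eta x =
        zeta (\row_(i < n) `|metric_proj (polar_cone ip (K i)) x|),
      sublinear eta,
      forall x, eta x = 0 <-> x = 0 &
      asymmetric_seminorm eta].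
Proof.
move=> ipN cccK capK [zeta_ge0 zeta_eq0 zetaZ zetaD] zeta_mono eta.
have eta_sub : sublinear eta.
  split=> [l x l0|x y]; rewrite /eta.
    rewrite -[X in X * _](ger0_norm l0) -zetaZ; congr zeta.
    by apply/rowP => i; rewrite !mxE (dist_coneZ ipN).
  apply: le_trans (zetaD _ _); apply: zeta_mono => i; rewrite !mxE.
  by split; [exact: dist_ge0|exact: (dist_coneD ipN)].
have eta_eq0 x : eta x = 0 <-> x = 0.
  split=> [/zeta_eq0 dist0|->]; last first.
    by have := eta_sub.1 0 0 (lexx _); rewrite scale0r mul0r.
  suff : (\bigcap_(i in [set: 'I_n]) K i) x by rewrite capK.
  move=> i _; apply/(dist_cone_eq0 ipN (cccK i)).
  by have /rowP/(_ i) := dist0; rewrite !mxE.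
split=> //.
  move=> x; congr zeta; apply/rowP => i; rewrite !mxE.
  rewrite (metric_proj_polar ipN (cccK i)).
  by have [_ ->] := metric_projP ipN (cccK i) x.
by split=> // [x|x /eta_eq0]; first exact: zeta_ge0.
Qed.
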